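(* In the setting below (with $\mathcal S=\{S,T,U\}$), if $\{S,T,U\}$ is in the LGV position on $G$, then $(A,E^* )$ is a Pfaffian parity with constant $c_P\operatorname{sgn}P$, where $P$ is an arbitrary disjoint $S$--$T$--$U$ path of $G$. In addition, if $G$ is equipped with a positive edge length $l:E\to\mathbb{R}_{>0}$ and $w:E^*\to\mathbb{R}$ is given by $w(e)=l(e)$ for $e\in E$ and $w(e)=0$ for $e\in E'$, there is a one-to-one correspondence between shortest disjoint $S$--$T$--$U$ paths of $G$ and minimum-weight parity bases of $(A,E^* )$ with respect to $w$.
   Context: $G=(V,E)$ is an undirected graph and $S_1=S$, $S_2=T$, $S_3=U$ are disjoint nonempty vertex subsets; $\Sigma=S\cup T\cup U$ has $|\Sigma|=2k$ and is ordered $u_1,\dots,u_{2k}$ with the vertices of $S$ first, then $T$, then $U$. No edge of $G$ joins two vertices of $\Sigma$. $\tilde V=V\setminus\Sigma$. $F_{2k}$ is the set of permutations $\sigma$ of $\{1,\dots,2k\}$ with $\sigma(1)<\sigma(3)<\dots<\sigma(2k-1)$ and $\sigma(2i-1)<\sigma(2i)$. A disjoint $S$--$T$--$U$ path is an edge set $P$, the union of $k$ pairwise vertex-disjoint paths $P_1,\dots,P_k$ such that for some (unique) $\sigma_P\in F_{2k}$, $P_i$ joins $u_{\sigma_P(2i-1)}$ and $u_{\sigma_P(2i)}$, lying in distinct sets among $S,T,U$; $\operatorname{sgn}P=\operatorname{sgn}\sigma_P$; its length is $\sum_{e\in P}l(e)$, shortest meaning minimum length. $\{S,T,U\}$ is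 in the LGV position if $\operatorname{sgn}P$ is the same for all such $P$. Fix pairwise linearly independent $b_1,b_2,b_3\in\mathbb{Q}^{1\times2}$; with $\alpha_i$ such that $u_{\sigma_P(i)}\in S_{\alpha_i}$, $c_P=\prod_{i=1}^k\det\begin{pmatrix}b_{\alpha_{2i-1}}\\ b_{\alpha_{2i}}\end{pmatrix}$. Let $v^*$ be a new vertex, $E'=\{\{v,v^*\}:v\in\tilde V\}$, $E^*=E\cup E'$. $A$ over $\mathbb{Q}$ has one row per terminal (rows $1,\dots,2k$ for $u_1,\dots,u_{2k}$) followed by two consecutive rows per $v\in\tilde V$, and two consecutive columns (a line) per $e\in E^*$; its blocks: for $e=\{u_i,v\}$ with $u_i\in S_\alpha$, $v\in\tilde V$: $b_\alpha$ at row $u_i$, $I_2$ at rows of $v$; for $e=\{v,v'\}\subseteq\tilde V$ with fixed arbitrary orientation $(v,v')$: $I_2$ at $v$, $-I_2$ at $v'$; for $e=\{v,v^*\}$: $I_2$ at $v$; all other blocks zero. A parity base is a set $B\subseteq E^*$ of lines whose columns form a nonsingular square submatrix $A[B]$ (original order); $(A,E^* )$ is a Pfaffian parity with constant $c\ne0$ if $\det A[B]=c$ for all parity bases; the weight of $B$ is $\sum_{e\in B}w(e)$.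
   Formalization: The Pfaffian constant is corrected from c_P sgn P to (-1)^k c_P sgn P: with the given blocks of A each of the k paths contributes -det(b_α; b_β), so the stated constant has the wrong sign for odd k (e.g. k=3, three disjoint two-edge paths). *)

(* Defs.v *)
From HB Require Import structures.
From mathcomp Require Import all_boot all_order all_fingroup all_algebra.

Set Implicit Arguments.
Unset Strict Implicit.
Unset Printing Implicit Defensive.

Import Order.TTheory GRing.Theory Num.Theory.
Local Open Scope ring_scope.

(* Ordinals of 'I_(n.*2) come in n consecutive pairs (2i, 2i+1); with indices
   starting at 1 these are the positions 2i-1 and 2i. *)
Definition lo n (i : 'I_n) : 'I_n.*2 :=
  Ordinal (etrans (ltn_double i n) (ltn_ord i)).
Definition hi n (i : 'I_n) : 'I_n.*2 :=
  Ordinal (etrans (ltn_Sdouble i n) (ltn_ord i)).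
Definition pair_of n (j : 'I_n.*2) : 'I_n :=
  Ordinal (etrans (ltn_half_double j n) (ltn_ord j)).
Definition coord_of n (j : 'I_n.*2) : 'I_2 := inord (odd j).

Section LineMatrix.

(* The j-th line of L owns the columns 2j and 2j+1 of A. *)
Variables (line : finType) (N m : nat).
Variables (L : m.-tuple line) (A : 'M[rat]_(N, m.*2)).

Definition columns (B : {set line}) : {set 'I_m.*2} :=
  [set j | tnth L (pair_of j) \in B].

(* Columns of the lines in B, in the order of A (enum_val is increasing on
   ordinals); conform_mx is the identity cast when #|columns B| = N, and the
   result is only used in that case. *)
Definition sub_lines (B : {set line}) : 'M[rat]_N :=
  conform_mx 0 (colsub (@enum_val _ (mem (columns B))) A).

Definition parity_base (B : {set line}) : Prop :=
  [/\ B \subset L, #|columns B| = N & \det (sub_lines B) != 0].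

Definition pfaffian_parity (c : rat) : Prop :=
  c != 0 /\ forall B, parity_base B -> \det (sub_lines B) = c.

Definition min_weight_base (R : realFieldType) (w : line -> R)
    (B : {set line}) : Prop :=
  parity_base B /\
  forall B', parity_base B' -> \sum_(e in B) w e <= \sum_(e in B') w e.

End LineMatrix.

Section Graph.

(* A simple graph on V is a set E of 2-element subsets of V. *)
Variables (V : finType) (E : {set {set V}}).

Definition simple_edges : Prop := forall e, e \in E -> #|e| = 2%N.

Definition adj : rel V := [rel x y | [set x; y] \in E].

(* The path with vertex sequence x :: p. *)
Definition is_path (x : V) (p : seq V) (y : V) : bool :=
  [&& path adj x p, uniq (x :: p) & last x p == y].

Definition path_edges (x : V) (p : seq V) : {set {set V}} :=
  [set:: [seq [set a.1; a.2] | a <- zip (x :: p) p]].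

(* The family Ss is (S_1, S_2, S_3) = (S, T, U). *)
Variable Ss : 'I_3 -> {set V}.

Definition terminals : {set V} := \bigcup_a Ss a.

(* The index alpha with v \in S_alpha; meaningful on terminals only. *)
Definition part_of (v : V) : 'I_3 := odflt ord0 [pick a | v \in Ss a].

Variables (k : nat) (u : k.*2.-tuple V).

Definition F2k (s : 'S_(k.*2)) : Prop :=
  (forall i j : 'I_k, (i < j)%N -> (s (lo i) < s (lo j))%N) /\
  (forall i : 'I_k, (s (lo i) < s (hi i))%N).

(* P is a disjoint S-T-U path, and s is its permutation sigma_P. *)
Definition stu_path_perm (P : {set {set V}}) (s : 'S_(k.*2)) : Prop :=
  F2k s /\
  exists p : 'I_k -> seq V,
    let x i := tnth u (s (lo i)) in
    let y i := tnth u (s (hi i)) in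
    [/\ forall i, is_path (x i) (p i) (y i),
        forall i, part_of (x i) != part_of (y i),
        forall i j, i != j -> [disjoint x i :: p i & x j :: p j]
      & P = \bigcup_i path_edges (x i) (p i)].

Definition stu_path (P : {set {set V}}) : Prop :=
  exists s, stu_path_perm P s.

Definition sgn (s : 'S_(k.*2)) : rat := (-1) ^+ odd_perm s.

Definition lgv_position : Prop :=
  forall P P' s s', stu_path_perm P s -> stu_path_perm P' s' -> sgn s = sgn s'.

Definition shortest_stu_path (R : realFieldType) (l : {set V} -> R)
    (P : {set {set V}}) : Prop :=
  stu_path P /\
  forall P', stu_path P' -> \sum_(e in P) l e <= \sum_(e in P') l e.

(* Lines: inl e is the edge e of G, inr v is the edge {v, v^*}. *)
Definition star_edges : {set {set V} + V} :=
  [set e | match e with inl e => e \in E | inr v => v \notin terminals end].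

(* The set of edges of G among a set of lines. *)
Definition graph_part (B : {set {set V} + V}) : {set {set V}} :=
  [set e | inl e \in B].

Definition star_weight (R : realFieldType) (l : {set V} -> R)
    (e : {set V} + V) : R :=
  match e with inl e => l e | inr _ => 0 end.

Variable b : 'I_3 -> 'rV[rat]_2.

Definition det2 (x y : V) : rat :=
  \det (col_mx (b (part_of x)) (b (part_of y)) : 'M_2).

Definition c_path (s : 'S_(k.*2)) : rat :=
  \prod_(i < k) det2 (tnth u (s (lo i))) (tnth u (s (hi i))).

(* An edge e inside V \ Sigma is oriented from tail e to its other end. *)
Variable tail : {set V} -> V.

(* The block of the line e at a terminal v. *)
Definition terminal_block (v : V) (e : {set V} + V) : 'rV[rat]_2 :=
  match e with
  | inl e => if v \in e then b (part_of v) else 0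
  | inr _ => 0
  end.

(* The block of the line e at a non-terminal v. *)
Definition inner_block (v : V) (e : {set V} + V) : 'M[rat]_2 :=
  match e with
  | inl e =>
      if v \notin e then 0
      else if (e \subset ~: terminals) && (v != tail e) then - 1%:M
      else 1%:M
  | inr w => if v == w then 1%:M else 0
  end.

Variables (n m : nat) (x : n.-tuple V) (L : m.-tuple ({set V} + V)%type).

Definition stu_matrix : 'M[rat]_(k.*2 + n.*2, m.*2) :=
  col_mx
    (\matrix_(i, j)
       terminal_block (tnth u i) (tnth L (pair_of j)) ord0 (coord_of j))
    (\matrix_(i, j)
       inner_block (tnth x (pair_of i)) (tnth L (pair_of j))
         (coord_of i) (coord_of j)).

End Graph.

(* Main.v *)
(* Idea. The left kernel of A[B] consists of potentials on the vertices that are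
   constant on the components of the subgraph B, vanish on every component
   carrying a line {v, v^*}, and at a terminal of S_a are multiples of b_a.  If B
   is a parity base, every component without such a line thus has two terminals
   in distinct parts, and |V| - |B| = k bounds the number of these components
   from below; so there are k of them, each with exactly two terminals, which
   yields the paths.  Adding to the row of one terminal of each pair the rows of
   the inner vertices of its component factors A[B] as Y (Z (x) I_2), with Z a
   signed incidence matrix: det Y is the product of the 2 x 2 determinants up to
   sgn, and det (Z (x) I_2) = (det Z)^2 = 1 by total unimodularity.  Conversely,
   a disjoint path P together with the lines {v, v^*} of the vertices off P is a
   parity base, and since l > 0 the minimum-weight bases are of this form. *)

Require Import Defs.
From mathcomp Require Import all_boot all_order all_fingroup all_algebra zify.

Set Implicit Arguments.
Unset Strict Implicit.
Unset Printing Implicit Defensive.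

Import Order.TTheory GRing.Theory Num.Theory.
Local Open Scope ring_scope.

(** * Indices grouped into consecutive pairs *)

Section DoubledOrdinals.

Variable n : nat.
Implicit Types (i : 'I_n) (j : 'I_n.*2).

Lemma pair_of_lo i : pair_of (lo i) = i.
Proof. by apply: val_inj; rewrite /= doubleK. Qed.

Lemma pair_of_hi i : pair_of (hi i) = i.
Proof. by apply: val_inj; rewrite /= uphalf_double. Qed.

Lemma coord_of_lo i : coord_of (lo i) = 0.
Proof.
rewrite /coord_of; have -> : odd (lo i) = false by exact: odd_double.
by apply: val_inj; rewrite /= inordK.
Qed.

Lemma coord_of_hi i : coord_of (hi i) = 1.
Proof.
rewrite /coord_of; have -> : odd (hi i) by rewrite /= odd_double.
by apply: val_inj; rewrite /= inordK.
Qed.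

Definition lohi (p : 'I_n * bool) : 'I_n.*2 := if p.2 then hi p.1 else lo p.1.

Lemma lohiK : cancel lohi (fun j => (pair_of j, odd j)).
Proof.
by case=> i []; rewrite /lohi ?pair_of_lo ?pair_of_hi /= odd_double.
Qed.

Lemma lohi_of_pair : cancel (fun j : 'I_n.*2 => (pair_of j, odd j)) lohi.
Proof.
move=> j; apply: val_inj; rewrite /lohi /=.
by case: ifP => oj /=; rewrite -[RHS]odd_double_half oj.
Qed.

Lemma lohiP j : (exists i, j = lo i) \/ (exists i, j = hi i).
Proof.
have := lohi_of_pair j; rewrite /lohi /=.
by case: ifP => _ <-; [right | left]; exists (pair_of j).
Qed.

Lemma lo_neq_hi i i' : (lo i == hi i') = false.
Proof.
apply/negP => /eqP/(congr1 (fun j : 'I_n.*2 => odd j)).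
by rewrite /= !odd_double.
Qed.

Lemma lo_inj : injective (@lo n).
Proof. by move=> i i' /(congr1 (@pair_of n)); rewrite !pair_of_lo. Qed.

Lemma hi_inj : injective (@hi n).
Proof. by move=> i i' /(congr1 (@pair_of n)); rewrite !pair_of_hi. Qed.

Lemma big_lohi (R : Type) (idx : R) (op : Monoid.com_law idx)
    (F : 'I_n.*2 -> R) :
  \big[op/idx]_j F j = \big[op/idx]_i op (F (lo i)) (F (hi i)).
Proof.
rewrite (reindex lohi); last by exists (fun j => (pair_of j, odd j)) => j _;
  rewrite ?lohiK ?lohi_of_pair.
rewrite -(pair_bigA _ (fun i c => F (lohi (i, c)))) /=.
by apply: eq_bigr => i _; rewrite big_bool Monoid.mulmC.
Qed.

End DoubledOrdinals.

(** * Increasing enumerations, and pairings as permutations *)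

Section Enumeration.

Lemma sorted_enum_ord n (A : {pred 'I_n}) : sorted (relpre val ltn) (enum A).
Proof.
rewrite {1}/enum_mem; apply: sorted_filter.
  by move=> a b c; exact: ltn_trans.
by rewrite -sorted_map -enumT val_enum_ord iota_ltn_sorted.
Qed.

Lemma enum_val_ltn n (A : {pred 'I_n}) (i j : 'I_#|A|) :
  (i < j)%N -> (enum_val i < enum_val j)%N.
Proof.
move=> ij; have x0 := enum_val i; rewrite !(enum_val_nth x0).
have := sorted_enum_ord A; rewrite sorted_pairwise; last first.
  by move=> a b c; exact: ltn_trans.
by move/(pairwiseP x0); apply; rewrite ?inE -?cardE.
Qed.

(** Both lists are strictly increasing with the same elements. This is what identifies the column
    order of [sub_lines]. *)
Lemma enum_increasing_image p q (f : 'I_p -> 'I_q) (A : {pred 'I_q}) :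
    {homo f : i j / (i < j)%N} -> A =i codom f ->
  enum A = codom f.
Proof.
move=> f_mono Af.
apply: (@irr_sorted_eq _ (relpre val ltn)).
- by move=> a b c; exact: ltn_trans.
- by move=> a /=; rewrite ltnn.
- exact: sorted_enum_ord.
- rewrite codomE sorted_map; apply: (@sub_sorted _ (relpre val ltn)) => [i j|].
    exact: f_mono.
  exact: sorted_enum_ord.
- by move=> j; rewrite mem_enum Af.
Qed.

Lemma enum_val_increasing_image p q (f : 'I_p -> 'I_q) (A : {pred 'I_q})
    (eq_p : p = #|A|) (i : 'I_p) :
    {homo f : i j / (i < j)%N} -> A =i codom f ->
  enum_val (cast_ord eq_p i) = f i.
Proof.
move=> f_mono Af; rewrite (enum_val_nth (f i)) /=.
rewrite (enum_increasing_image f_mono Af) codomE (nth_map i) ?size_enum_ord //.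
by rewrite nth_ord_enum.
Qed.

(* s lists the orbits of f, sorted by their smaller elements. *)
Lemma F2k_of_involution k (f : 'I_k.*2 -> 'I_k.*2) :
    involutive f -> (forall j, f j != j) ->
  exists2 s : 'S_(k.*2), F2k s & forall i, f (s (lo i)) = s (hi i).
Proof.
move=> fK f_neq; pose S := [set j : 'I_k.*2 | (j < f j)%N].
have cardS : #|S| = k.
  (* Having no fixed point, [f] exchanges [S] with its complement, so [S] has half of the [k.*2]
     elements. *)
  have CS : ~: S = f @: S.
    apply/setP=> j; rewrite (can2_imset_pre _ fK fK) !inE fK -leqNgt leq_eqVlt.
    by have := f_neq j; rewrite -val_eqE /= => /negPf->.
  have := cardsC S; rewrite CS card_imset ?card_ord; last exact: can_inj fK.
  by rewrite addnn => /double_inj.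
pose g i := enum_val (cast_ord (esym cardS) i).
have gS i : (g i < f (g i))%N by have := enum_valP (cast_ord (esym cardS) i);
  rewrite inE.
have g_inj : injective g by move=> i j /enum_val_inj/cast_ord_inj.
pose h j := let i := pair_of j in if odd j then f (g i) else g i.
have h_inj : injective h.
  have gf i j : g i = f (g j) -> False.
    move=> e; have := gS i; have := gS j; rewrite e fK => /ltn_trans lt /lt.
    by rewrite ltnn.
  move=> j j'; rewrite -{2}(lohi_of_pair j) -{2}(lohi_of_pair j') /h /lohi /=.
  case: ifP => _; case: ifP => _.
  - by move/(can_inj fK)/g_inj->.
  - by move/esym/gf.
  - by move/gf.
  - by move/g_inj->.
have hlo i : perm h_inj (lo i) = g i.
  by rewrite permE /h pair_of_lo /= odd_double.
have hhi i : perm h_inj (hi i) = f (g i).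
  by rewrite permE /h pair_of_hi /= odd_double.
exists (perm h_inj); last by move=> i; rewrite hlo hhi.
split=> [i j ij|i]; rewrite ?hlo ?hhi //.
exact: enum_val_ltn.
Qed.

End Enumeration.

(** * Determinants of doubled, block diagonal and incidence matrices *)

Section Determinants.

Variable R : comNzRingType.

(** Rows and columns are permuted alike, so the two signs cancel. Keeping [m] and [n] apart covers
    reindexing between different forms of one dimension. *)
Lemma det_reindex m n (f : 'I_m -> 'I_n) (A : 'M[R]_n) :
  bijective f -> \det (mxsub f f A) = \det A.
Proof.
move=> bij_f; have /esym := bij_eq_card bij_f; rewrite !card_ord => eq_nm.
case: _ / eq_nm f bij_f => f /bij_inj f_inj.
have -> : mxsub f f A = row_perm (perm f_inj) (col_perm (perm f_inj) A).
  by apply/matrixP=> i j; rewrite !mxE !permE.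
rewrite row_permE col_permE !det_mulmx !det_perm mulrC -mulrA -signr_addb.
by rewrite odd_permV addbb mulr1.
Qed.

(* A (x) I_2, with the indices interleaved. *)
Definition doubled m n (A : 'M[R]_(m, n)) : 'M[R]_(m.*2, n.*2) :=
  \matrix_(i, j) (A (pair_of i) (pair_of j) *+ (coord_of i == coord_of j)).

(** Moving the even indices before the odd ones, in rows and columns alike, leaves two diagonal
    copies of [A]. *)
Lemma det_doubled n (A : 'M[R]_n) : \det (doubled A) = \det A ^+ 2.
Proof.
pose f (j : 'I_n.*2) : 'I_(n + n) :=
  let i := pair_of j in if odd j then rshift n i else lshift n i.
pose g (j : 'I_(n + n)) : 'I_n.*2 :=
  match split j with inl i => lo i | inr i => hi i end.
have bij_f : bijective f.
  exists g => j; rewrite /f /g.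
    have := lohi_of_pair j; rewrite /lohi /=.
    by case: ifP => _ {2}<-;
      [rewrite (unsplitK (inr _)) | rewrite (unsplitK (inl _))].
  case: splitP => i e; apply: val_inj; rewrite /= odd_double /= e.
    by rewrite doubleK.
  by rewrite uphalf_double.
have -> : doubled A = mxsub f f (block_mx A 0 0 A).
  apply/matrixP=> i j; rewrite [LHS]mxE [RHS]mxE /f.
  have [[a ->]|[a ->]] := lohiP i; have [[c ->]|[c ->]] := lohiP j;
    rewrite !(pair_of_lo, pair_of_hi, coord_of_lo, coord_of_hi) /= !odd_double /=.
  - by rewrite block_mxEul.
  - by rewrite block_mxEur mxE.
  - by rewrite block_mxEdl mxE.
  - by rewrite block_mxEdr.
by rewrite det_reindex // det_ublock expr2.
Qed.

Lemma det_pairs k (B : 'I_k -> 'M[R]_2) :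
  \det (\matrix_(i, j < k.*2)
    (B (pair_of i) (coord_of i) (coord_of j) *+ (pair_of i == pair_of j)))
  = \prod_i \det (B i).
Proof.
elim: k B => [|k IHk] B.
  by rewrite big_ord0 det_mx00.
set M := (X in \det X).
have -> : M = block_mx (B ord0) 0 0 (\matrix_(i, j < k.*2)
    (B (lift ord0 (pair_of i)) (coord_of i) (coord_of j)
       *+ (pair_of i == pair_of j))) :> 'M_(2 + k.*2).
  apply/matrixP=> i j; rewrite [LHS]mxE.
  have pl (a : 'I_2) : pair_of (lshift k.*2 a : 'I_k.+1.*2) = ord0.
    by apply: val_inj; case: a => [[|[]]].
  have pr (a : 'I_k.*2) :
      pair_of (rshift 2 a : 'I_k.+1.*2) = lift ord0 (pair_of a).
    exact: val_inj.
  have cl (a : 'I_2) : coord_of (lshift k.*2 a : 'I_k.+1.*2) = a.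
    by apply: val_inj; case: a => [[|[]]] //= *; rewrite inordK.
  have cr (a : 'I_k.*2) : coord_of (rshift 2 a : 'I_k.+1.*2) = coord_of a.
    by rewrite /coord_of /= negbK.
  case: (split_ordP i) => a ->; case: (split_ordP j) => c ->.
  - by rewrite block_mxEul pl pl cl cl.
  - by rewrite block_mxEur pl pr mxE.
  - by rewrite block_mxEdl pl pr mxE.
  - by rewrite block_mxEdr pr pr cr cr mxE (inj_eq lift_inj).
apply: (etrans (@det_ublock R 2 k.*2 _ _ _)).
by rewrite (IHk (fun i => B (lift ord0 i))) big_ord_recl.
Qed.

End Determinants.

(* Total unimodularity: either the rows sum to zero, or some column has a single
   nonzero entry. *)
Lemma det_incidence (R : numDomainType) n (A : 'M[R]_n) :
    (forall i j, A i j \in [:: 0; 1; -1]) ->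
    (forall i i' j, A i j = A i' j -> A i j != 0 -> i = i') ->
  \det A != 0 -> \det A ^+ 2 = 1.
Proof.
elim: n A => [|n IHn] A A01 A_inj; first by rewrite det_mx00 expr1n.
have [/forallP sum0|] := boolP [forall j, \sum_i A i j == 0].
  suff -> : \det A = 0 by rewrite eqxx.
  apply/eqP/det0P; exists (const_mx 1).
    by apply/eqP=> /matrixP/(_ ord0 ord0)/eqP; rewrite !mxE oner_eq0.
  apply/rowP=> j; rewrite !mxE -[RHS](eqP (sum0 j)).
  by apply: eq_bigr => i _; rewrite mxE mul1r.
rewrite negb_forall => /existsP[j sum_neq0].
have [i0 Ai0] : exists i0, A i0 j != 0.
  apply/existsP; rewrite -negb_forall; apply: contra sum_neq0 => /forallP A0.
  by rewrite big1 // => i _; apply/eqP/A0.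
have A1 i : A i j != 0 -> A i j = 1 \/ A i j = -1.
  by have := A01 i j; rewrite !inE => /or3P[]/eqP->; rewrite ?eqxx; auto.
(* Nonzero entries of a column are distinct, so a second one is the opposite of the first and no
   value is left for a third; the column would then sum to zero. *)
have only_i0 i : i != i0 -> A i j = 0.
  move=> neq; apply/eqP/negPn/negP => Ai; case/negP: sum_neq0.
  have eqN : A i j = - A i0 j.
    have := fun e => A_inj i i0 j e Ai.
    case: (A1 i Ai) (A1 i0 Ai0) => -> [] -> /=; rewrite ?opprK // => ne;
    by move/eqP: neq; rewrite ne.
  rewrite (bigD1 i0) //= (bigD1 i) //= eqN addrA subrr add0r big1 //.
  move=> i' /andP[ne1 ne2]; apply/eqP/negPn/negP => Ai'.
  have [e|e] : A i' j = A i0 j \/ A i' j = A i j.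
  - rewrite eqN; case: (A1 i' Ai') (A1 i0 Ai0) => -> [] ->;
      rewrite ?opprK; auto.
  - by move/eqP: ne1; rewrite (A_inj _ _ _ e).
  - by move/eqP: ne2; rewrite (A_inj _ _ _ e).
rewrite (expand_det_col _ j) (bigD1 i0) //= big1 ?addr0; last first.
  by move=> i /only_i0->; rewrite mul0r.
rewrite /cofactor mulf_eq0 mulf_eq0 signr_eq0 (negPf Ai0) /= => det0.
rewrite exprMn exprMn sqrr_sign mul1r IHn ?mulr1 //.
- by case: (A1 i0 Ai0) => ->; rewrite ?sqrrN expr1n.
- by move=> i i'; rewrite !mxE.
- by move=> i i' j'; rewrite !mxE => e ne; apply: (@lift_inj _ i0); apply: A_inj ne.
Qed.

(** * The square submatrix selected by a set of lines *)

Section ColumnSelection.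

Variables (line : finType) (N m : nat).
Variables (L : m.-tuple line) (A : 'M[rat]_(N, m.*2)).
Implicit Types B : {set line}.

Definition line_set B : {set 'I_m} := [set t | tnth L t \in B].

Lemma card_line_set B : uniq L -> B \subset L -> #|line_set B| = #|B|.
Proof.
move=> uL /subsetP BL; rewrite -(card_imset _ (elimT (tuple_uniqP L) uL)).
apply: eq_card => e; apply/imsetP/idP => [[t]|eB]; first by rewrite inE => ? ->.
by have /tnthP[t et] := BL e eB; exists t; rewrite // inE -et.
Qed.

(** An explicit form of the increasing enumeration of the columns of [B], in which the line and the
    coordinate of a column can be read off. *)
Definition line_cols B (j : 'I_#|line_set B|.*2) : 'I_m.*2 :=
  lohi (enum_val (pair_of j), odd j).

Lemma pair_of_line_cols B j : pair_of (@line_cols B j) = enum_val (pair_of j).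
Proof. by case: (lohiK (enum_val (pair_of j) : 'I_m, odd j)). Qed.

Lemma coord_of_line_cols B j : coord_of (@line_cols B j) = coord_of j.
Proof.
by case: (lohiK (enum_val (pair_of j) : 'I_m, odd j)) => _; rewrite /coord_of => ->.
Qed.

Lemma line_cols_ltn B : {homo @line_cols B : i j / (i < j)%N}.
Proof.
move=> i j ij.
pose T (a : 'I_#|line_set B|.*2) : nat := enum_val (pair_of a).
have val_cols a : line_cols a = (odd a + (T a).*2)%N :> nat.
  by rewrite /line_cols /lohi /T /=; case: (odd a).
rewrite !val_cols; have := odd_double_half i; have := odd_double_half j.
case: (ltngtP i./2 j./2) => [lt|gt|e]; [|lia|]; last first.
  have -> : T i = T j by rewrite /T; congr (val (enum_val _)); exact: val_inj.
  by lia.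
have : (T i < T j)%N by exact: enum_val_ltn.
by lia.
Qed.

Lemma mem_line_cols B : columns L B =i codom (@line_cols B).
Proof.
move=> j; rewrite inE; apply/idP/codomP => [jB|[i ->]].
  have jT : pair_of j \in line_set B by rewrite inE.
  exists (lohi (enum_rank_in jT (pair_of j), odd j)); rewrite /line_cols.
  case: (lohiK (enum_rank_in jT (pair_of j), odd j)) => -> ->.
  by rewrite enum_rankK_in // lohi_of_pair.
by rewrite pair_of_line_cols; have := enum_valP (pair_of i); rewrite inE.
Qed.

Lemma card_columns B : #|columns L B| = #|line_set B|.*2.
Proof.
rewrite (cardE (columns L B)).
by rewrite (enum_increasing_image (@line_cols_ltn B) (@mem_line_cols B)) size_codom card_ord.
Qed.

Lemma sub_lines_colsub B (eqN : N = #|columns L B|) :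
  sub_lines L A B = colsub (enum_val \o cast_ord eqN) A.
Proof.
(* The enumeration is generalized to an arbitrary function so that the cardinal in its type can be
   replaced by [N]; [conform_mx] is then the identity. *)
rewrite /sub_lines; set F := enum_val.
have -> : F = enum_val by [].
move: (enum_val : 'I_#|columns L B| -> 'I_m.*2) => {}F.
case: _ / eqN F => F; rewrite conform_mx_id; apply/matrixP=> i j.
by rewrite !mxE /= cast_ord_id.
Qed.

Lemma sub_linesE B (eqN : N = #|line_set B|.*2) i j :
  sub_lines L A B i j = A i (line_cols (cast_ord eqN j)).
Proof.
have eqN' : N = #|columns L B| by rewrite card_columns.
rewrite (sub_lines_colsub eqN') mxE /=.
rewrite -(enum_val_increasing_image (esym (card_columns B)) _
  (@line_cols_ltn B) (@mem_line_cols B)).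
by congr (A i (enum_val _)); apply: val_inj.
Qed.

Lemma parity_base_ker B (r : 'rV_N) :
    parity_base L A B -> (forall j, j \in columns L B -> (r *m A) 0 j = 0) ->
  r = 0.
Proof.
case=> _ /esym eqN det_neq0 r0; apply: contraNeq det_neq0 => r_neq0.
apply/det0P; exists r => //; rewrite (sub_lines_colsub eqN) mulmx_colsub.
by apply/rowP=> j; rewrite !mxE -[RHS](r0 _ (enum_valP (cast_ord eqN j))) mxE.
Qed.

(** An upper bound on the number of columns is enough: a trivial left kernel gives rank [N], hence
    at least [N] columns. *)
Lemma parity_base_of_ker B :
    B \subset L -> (#|columns L B| <= N)%N ->
    (forall r : 'rV_N,
      (forall j, j \in columns L B -> (r *m A) 0 j = 0) -> r = 0) ->
  parity_base L A B.
Proof.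
move=> BL le_BN ker0.
have free_cols : row_free (colsub (@enum_val _ (mem (columns L B))) A).
  rewrite -kermx_eq0; apply/eqP/row_matrixP => i; rewrite row0; apply: ker0 => j jB.
  have := mulmx_ker (colsub (@enum_val _ (mem (columns L B))) A).
  move/(congr1 (row i)); rewrite row_mul row0 mulmx_colsub.
  by move/rowP/(_ (enum_rank_in jB j)); rewrite mxE enum_rankK_in // [RHS]mxE.
have eqN : N = #|columns L B|.
  by apply/eqP; rewrite eqn_leq le_BN andbT -(eqP free_cols) rank_leq_col.
split; [by [] | exact: esym | apply/negP => /det0P[r r_neq0]].
rewrite (sub_lines_colsub eqN) mulmx_colsub => /rowP r0; case/eqP: r_neq0.
apply: ker0 => j jB; have := r0 (cast_ord (esym eqN) (enum_rank_in jB j)).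
by rewrite !mxE /= cast_ordKV enum_rankK_in // => ->.
Qed.

End ColumnSelection.

(** * The signed incidence matrix of the lines *)

Section Incidence.

Variables (V : finType) (E : {set {set V}}) (Ss : 'I_3 -> {set V}).
Variable tail : {set V} -> V.
Hypothesis simpleE : simple_edges E.
Hypothesis no_terminal_edge : forall e, e \in E -> ~~ (e \subset terminals Ss).
Hypothesis tail_end :
  forall e, e \in E -> e \subset ~: terminals Ss -> tail e \in e.

(** The scalar matrix behind the blocks of [A]. Terminals get -1 so that each edge of [E] has one
    entry 1 and one entry -1; a star line has a single 1, the row of [v^*] being absent. *)
Definition incidence (v : V) (e : {set V} + V) : rat :=
  if v \in terminals Ss then
    match e with inl e => - (v \in e)%:R | inr _ => 0 end
  else
    match e with
    | inl e => if v \notin e then 0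
               else if (e \subset ~: terminals Ss) && (v != tail e) then -1
               else 1
    | inr w => (v == w)%:R
    end.

Lemma terminal_block_incidence b v e :
  v \in terminals Ss ->
  terminal_block Ss b v e = - incidence v e *: b (part_of Ss v).
Proof.
move=> vT; rewrite /terminal_block /incidence vT.
case: e => [e|_]; last by rewrite oppr0 scale0r.
by case: (v \in e); rewrite ?oppr0 ?scale0r // opprK scale1r.
Qed.

Lemma inner_block_incidence v e :
  v \notin terminals Ss -> inner_block Ss tail v e = (incidence v e)%:M.
Proof.
move=> /negPf vT; rewrite /inner_block /incidence vT.
case: e => [e|w]; last by case: (v == w); rewrite // raddf0.
case: (v \notin e); first by rewrite raddf0.
by case: ifP => _ //; rewrite raddfN.
Qed.

Lemma incidence_notin v (e : {set V}) : v \notin e -> incidence v (inl e) = 0.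
Proof. by move=> ve; rewrite /incidence ve (negPf ve) oppr0 if_same. Qed.

Lemma incidence_edge (e : {set V}) : e \in E ->
  exists a c, [/\ e = [set a; c], a != c,
                  incidence a (inl e) = 1 & incidence c (inl e) = -1].
Proof.
move=> eE; have /eqP/cards2P[a [c [ac de]]] := simpleE eE.
have ae : a \in e by rewrite de set21.
have ce : c \in e by rewrite de set22.
have sub2 (A : {set V}) : e \subset A = (a \in A) && (c \in A).
  by rewrite de subUset !sub1set.
have := no_terminal_edge eE; rewrite sub2.
have := tail_end eE; rewrite sub2 !in_setC.
have inc v : v \in e -> incidence v (inl e) =
    if v \in terminals Ss then -1
    else if (e \subset ~: terminals Ss) && (v != tail e) then -1 else 1.
  by rewrite /incidence => ->.
have := inc a ae; have := inc c ce; rewrite sub2 !in_setC => {inc}.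
case aT: (a \in terminals Ss) => /=; case cT: (c \in terminals Ss) => //= ic ia te _.
- by exists c, a; rewrite ia ic eq_sym setUC.
- by exists a, c; rewrite ia ic.
have : tail e \in [set a; c] by rewrite -de te.
rewrite !inE => /orP[]/eqP te1.
  by exists a, c; rewrite ia ic te1 eqxx ac eq_sym ac.
by exists c, a; rewrite ia ic te1 eqxx ac eq_sym ac setUC.
Qed.

Lemma incidence_star v w : w \notin terminals Ss ->
  incidence v (inr w) = (v == w)%:R.
Proof.
move=> wT; rewrite /incidence; case: ifP => // vT.
by case: eqP => // e; rewrite -e vT in wT.
Qed.

Lemma sum_incidence_edge (f : V -> rat) (e : {set V}) : e \in E ->
  exists a c, [/\ e = [set a; c], a != c &
                  \sum_v f v * incidence v (inl e) = f a - f c].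
Proof.
move=> /incidence_edge[a [c [de ac ia ic]]]; exists a, c; split=> //.
rewrite (bigD1 a) //= (bigD1 c) 1?eq_sym //= big1 ?addr0.
  by rewrite ia ic mulr1 mulrN1.
move=> v /andP[va vc]; rewrite incidence_notin ?mulr0 //.
by rewrite de !inE negb_or va.
Qed.

Lemma sum_incidence_eq0 (f : V -> rat) v w : [set v; w] \in E ->
  \sum_z f z * incidence z (inl [set v; w]) = 0 -> f v = f w.
Proof.
move=> /(sum_incidence_edge f)[a [c [de _ ->]]] /eqP.
rewrite subr_eq0 => /eqP ac.
have f_a z : z \in [set v; w] -> f z = f a.
  by rewrite de !inE => /orP[]/eqP->.
by rewrite !f_a ?set21 ?set22.
Qed.

Lemma sum_incidence_star (f : V -> rat) w : w \notin terminals Ss ->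
  \sum_v f v * incidence v (inr w) = f w.
Proof.
move=> wT; rewrite (bigD1 w) //= big1 ?addr0 ?incidence_star ?eqxx ?mulr1 //.
by move=> v /negPf vw; rewrite incidence_star // vw mulr0.
Qed.

Lemma incidence_entry v e : incidence v e \in [:: 0; 1; -1].
Proof.
rewrite /incidence; case: e => e; do ![case: ifP => _]; rewrite ?inE ?eqxx ?orbT //.
  by case: (v \in e); rewrite ?oppr0 ?eqxx ?orbT.
by case: (v == e); rewrite eqxx ?orbT.
Qed.

(** The two nonzero entries of an edge are opposite, and a star line has only one. This is the
    column condition of [det_incidence]. *)
Lemma incidence_inj v w e : e \in star_edges E Ss ->
  incidence v e = incidence w e -> incidence v e != 0 -> v = w.
Proof.
rewrite inE; case: e => [e eE|e eT]; last first.
  by rewrite !incidence_star //; case: eqP => [->|_]; case: eqP.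
have [a [c [de ac ia ic]]] := incidence_edge eE => eq_vw v0.
have mem z : incidence z (inl e) != 0 -> z = a \/ z = c.
  have [|/incidence_notin->] := boolP (z \in e); last by rewrite eqxx.
  by rewrite de !inE => /orP[]/eqP; auto.
have w0 : incidence w (inl e) != 0 by rewrite -eq_vw.
by case: (mem _ v0) (mem _ w0) eq_vw => -> [] -> //; rewrite ia ic => /eqP.
Qed.

End Incidence.

(** * Row vectors as potentials on the vertices *)

Section Potential.

Variables (V : finType) (Ss : 'I_3 -> {set V}).
Variables (k n m : nat) (u : k.*2.-tuple V) (x : n.-tuple V).
Variables (L : m.-tuple ({set V} + V)%type).
Variables (b : 'I_3 -> 'rV[rat]_2) (tail : {set V} -> V).
Hypothesis (u_uniq : uniq u) (u_enum : u =i terminals Ss).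
Hypothesis (x_uniq : uniq x) (x_enum : x =i ~: terminals Ss).

Notation A := (stu_matrix Ss u b tail x L).
Notation inc := (incidence Ss tail).

Lemma tnth_u_terminal i : tnth u i \in terminals Ss.
Proof. by rewrite -u_enum mem_tnth. Qed.

Lemma tnth_x_inner i : tnth x i \notin terminals Ss.
Proof. by rewrite -in_setC -x_enum mem_tnth. Qed.

Lemma vertexP v : (exists i, v = tnth u i) \/ (exists i, v = tnth x i).
Proof.
case vT: (v \in terminals Ss).
  by left; apply/tnthP; rewrite u_enum.
by right; apply/tnthP; rewrite x_enum inE vT.
Qed.

Lemma sum_vertices (F : V -> rat) :
  \sum_v F v = \sum_i F (tnth u i) + \sum_i F (tnth x i).
Proof.
rewrite (bigID (mem (terminals Ss))) /=; congr (_ + _).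
  by rewrite -(eq_bigl _ _ u_enum) -big_uniq // big_tuple.
transitivity (\sum_(v <- x) F v); last exact: big_tuple.
rewrite big_uniq //; apply: eq_bigl => v.
by rewrite x_enum inE.
Qed.

Lemma card_vertices : #|V| = (k.*2 + n)%N.
Proof.
rewrite -[in RHS](size_tuple u) -[in RHS](size_tuple x).
rewrite -(card_uniqP u_uniq) -(card_uniqP x_uniq).
by rewrite (eq_card u_enum) (eq_card x_enum) cardsC.
Qed.

(* A row vector r extends to a potential V -> rat^2 whose value at a terminal t
   is - r_t b_t; the product r A then consists of the potential differences
   along the lines. *)
Definition potential (r : 'rV[rat]_(k.*2 + n.*2)) (c : 'I_2) (v : V) : rat :=
  if [pick i | tnth u i == v] is Some i then
    - (r 0 (lshift n.*2 i) * b (part_of Ss v) 0 c)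
  else if [pick i | tnth x i == v] is Some i then
    r 0 (rshift k.*2 (lohi (i, c != 0)))
  else 0.

Lemma potential_u r c i :
  potential r c (tnth u i) =
    - (r 0 (lshift n.*2 i) * b (part_of Ss (tnth u i)) 0 c).
Proof.
rewrite /potential; case: pickP => [j|/(_ i)]; last by rewrite eqxx.
by move/eqP/(elimT (tuple_uniqP u) u_uniq)->.
Qed.

Lemma potential_x r c i :
  potential r c (tnth x i) = r 0 (rshift k.*2 (lohi (i, c != 0))).
Proof.
rewrite /potential; case: pickP => [j /eqP e|_].
  by have := tnth_x_inner i; rewrite -e tnth_u_terminal.
case: pickP => [j|/(_ i)]; last by rewrite eqxx.
by move/eqP/(elimT (tuple_uniqP x) x_uniq)->.
Qed.

(** Inner blocks are scalar matrices, so column [j] sees only the coordinate [coord_of j] of the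
    potential. The sign of the potential at terminals matches the one in
    [terminal_block_incidence]. *)
Lemma mul_stu_matrix r j :
  (r *m A) 0 j =
    \sum_v potential r (coord_of j) v * inc v (tnth L (pair_of j)).
Proof.
rewrite mxE big_split_ord sum_vertices /=; congr (_ + _).
  apply: eq_bigr => i _; rewrite potential_u col_mxEu mxE.
  rewrite (terminal_block_incidence tail) ?tnth_u_terminal // mxE.
  by rewrite mulNr mulrN mulNr mulrCA mulrC.
rewrite big_lohi; apply: eq_bigr => i _.
rewrite potential_x !col_mxEd !mxE !pair_of_lo !pair_of_hi.
rewrite coord_of_lo coord_of_hi inner_block_incidence ?tnth_x_inner // !mxE.
case: (coord_of j) => [[|[|//]] lt] /=.
  by rewrite mulr1n mulr0n mulr0 addr0.
by rewrite mulr1n mulr0n mulr0 add0r.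
Qed.

End Potential.

(** * Components of the subgraph of a parity base *)

Lemma adj_connect_sym (V : finType) (G : {set {set V}}) :
  connect_sym (adj G).
Proof. by apply: sym_connect_sym => v w; rewrite /adj /= setUC. Qed.

Lemma connect_invariant (V : finType) (T : Type) (e : rel V) (f : V -> T) v w :
  (forall v w, e v w -> f v = f w) -> connect e v w -> f v = f w.
Proof.
move=> fe /connectP[p]; elim: p v => [v _ ->|z p IHp v] //=.
by case/andP=> /fe-> /IHp /[apply].
Qed.

Section Components.

Variables (V : finType) (E : {set {set V}}) (Ss : 'I_3 -> {set V}).
Variables (k n m : nat) (u : k.*2.-tuple V) (x : n.-tuple V).
Variables (L : m.-tuple ({set V} + V)%type).
Variables (b : 'I_3 -> 'rV[rat]_2) (tail : {set V} -> V).
Hypothesis simpleE : simple_edges E.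
Hypothesis no_terminal_edge : forall e, e \in E -> ~~ (e \subset terminals Ss).
Hypothesis (u_uniq : uniq u) (u_enum : u =i terminals Ss).
Hypothesis (x_uniq : uniq x) (x_enum : x =i ~: terminals Ss).
Hypothesis L_enum : L =i star_edges E Ss.
Hypothesis
  b_indep : forall a a', a != a' -> row_free (col_mx (b a) (b a')).
Hypothesis tail_end :
  forall e, e \in E -> e \subset ~: terminals Ss -> tail e \in e.

Notation A := (stu_matrix Ss u b tail x L).
Notation inc := (incidence Ss tail).
Notation linked B := (connect (adj (graph_part B))).
Implicit Type B : {set {set V} + V}.

(** This stands for a connection from [v] to [v^*] through the lines of [B], since [v^*] is not an
    element of [V]. *)
Definition starred B v := [exists w, linked B v w && (inr w \in B)].

Lemma linked_sym B v w : linked B v w = linked B w v.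
Proof. exact: adj_connect_sym. Qed.

Lemma linked_edge B v (e : {set V}) a c :
  inl e \in B -> e = [set a; c] -> linked B v a = linked B v c.
Proof.
move=> eB de; have ac : linked B a c.
  by apply: connect1; rewrite /adj /= inE -de.
by apply/idP/idP => /connect_trans; apply; rewrite // linked_sym.
Qed.

(** The indicator of a component agrees at both ends of every edge of [B], and an unstarred
    component contains no end of a star line of [B]. *)
Lemma component_incidence_sum B v e :
    B \subset L -> e \in B -> ~~ starred B v ->
  \sum_w (linked B v w)%:R * inc w e = 0.
Proof.
move=> /subsetP BL eB vS; have := BL e eB; rewrite L_enum inE.
case: e eB => [e|w] eB eE; last first.
  rewrite sum_incidence_star //; case vw: (linked B v w) => //.
  by case/existsP: vS; exists w; rewrite vw.
have [a [c [de _ ->]]] := sum_incidence_edge simpleE no_terminal_edge tail_end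
  (fun w => (linked B v w)%:R) eE.
by rewrite (linked_edge v eB de) subrr.
Qed.

Lemma b_indep_eq0 a a' (y y' : rat) : a != a' -> y *: b a = y' *: b a' -> y = 0.
Proof.
move=> /b_indep free_b e.
have : row_mx y%:M (- y'%:M) = 0 :> 'rV[rat]_(1 + 1).
  apply: (row_free_inj free_b).
  by rewrite mul0mx mul_row_col mulNmx !mul_scalar_mx e subrr.
move/(congr1 lsubmx); rewrite row_mxKl linear0 => /matrixP/(_ 0 0).
by rewrite !mxE eqxx mulr1n.
Qed.

Lemma b_neq0 a : b a != 0.
Proof.
have [a' aa'] : exists a', a != a'.
  by case: (eqVneq a 0) => [->|]; [exists 1 | exists 0].
apply/eqP => ba0; suff /eqP : (1 : rat) = 0 by rewrite oner_eq0.
by apply: (b_indep_eq0 (y' := 0) aa'); rewrite ba0 scaler0 scale0r.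
Qed.

(** Otherwise a potential equal to one fixed nonzero vector on the component and to zero elsewhere
    comes from a nonzero row vector killing all columns of [B]. *)
Lemma component_two_parts B v : parity_base L A B -> ~~ starred B v ->
  exists i j, [/\ linked B v (tnth u i), linked B v (tnth u j) &
                  part_of Ss (tnth u i) != part_of Ss (tnth u j)].
Proof.
move=> baseB vS; have [BL _ _] := baseB.
have [|/existsPn no_parts] := boolP [exists i, exists j,
    [&& linked B v (tnth u i), linked B v (tnth u j)
      & part_of Ss (tnth u i) != part_of Ss (tnth u j)]].
  by case/existsP=> i /existsP[j /and3P[]]; exists i, j.
(* [beta] is the vector of the common part; for a component without terminals any nonzero vector
   serves, here [b 0]. *)
pose beta := if [pick i | linked B v (tnth u i)] is Some i
             then b (part_of Ss (tnth u i)) else b 0.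
have beta_neq0 : beta != 0 by rewrite /beta; case: pickP => *; exact: b_neq0.
have betaE i : linked B v (tnth u i) -> b (part_of Ss (tnth u i)) = beta.
  rewrite /beta; case: pickP => [j vj|/(_ i)->//] vi.
  congr b; apply/eqP; have /existsPn/(_ j) := no_parts i.
  by rewrite vi vj /= negbK.
(* The minus sign at terminals undoes the one in [potential]. *)
pose r : 'rV[rat]_(k.*2 + n.*2) :=
  row_mx (\row_i - (linked B v (tnth u i))%:R)
         (\row_i ((linked B v (tnth x (pair_of i)))%:R * beta 0 (coord_of i))).
have pot_r c w : potential Ss u x b r c w = (linked B v w)%:R * beta 0 c.
  have [[i ->]|[i ->]] := vertexP u_enum x_enum w.
    rewrite potential_u // row_mxEl mxE mulNr opprK.
    by case vi: (linked _ _ _); rewrite ?mul0r // betaE.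
  rewrite (potential_x _ u_enum x_uniq x_enum) row_mxEr mxE.
  case: c => [[|[|//]] lt]; rewrite /lohi /= ?pair_of_lo ?pair_of_hi.
    by rewrite coord_of_lo; congr (_ * beta _ _); exact: val_inj.
  by rewrite coord_of_hi; congr (_ * beta _ _); exact: val_inj.
have r0 : r = 0.
  apply: (parity_base_ker baseB) => j; rewrite inE => jB.
  rewrite (mul_stu_matrix _ _ _ u_uniq u_enum x_uniq x_enum).
  under eq_bigr do rewrite pot_r mulrAC.
  by rewrite -mulr_suml component_incidence_sum // mul0r.
have [c beta_c] : exists c, beta 0 c != 0.
  apply/existsP; rewrite -negb_forall; apply: contra beta_neq0 => /forallP bc.
  by apply/eqP/rowP=> c; rewrite mxE; apply/eqP.
have := pot_r c v; rewrite connect0 mul1r => e; case/negP: beta_c.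
rewrite -e r0; have [[i ->]|[i ->]] := vertexP u_enum x_enum v.
  by rewrite potential_u // mxE mul0r oppr0.
by rewrite (potential_x _ u_enum x_uniq x_enum) mxE.
Qed.

Lemma card_parity_base B : parity_base L A B -> #|line_set L B| = (k + n)%N.
Proof. by case=> _ + _; rewrite card_columns -doubleD => /double_inj. Qed.

Definition unstarred_roots B : {set V} :=
  [set v in roots (adj (graph_part B)) | ~~ starred B v].

Lemma starred_linked B v w : linked B v w -> starred B v = starred B w.
Proof.
move=> vw; apply: eq_existsb => z; congr (_ && _).
by apply/idP/idP => /(connect_trans _); apply; rewrite // linked_sym.
Qed.

(** The left kernel of the scalar incidence matrix of [B] has dimension at least (2k + n) - (k + n)
    = k. Its vectors are constant on components and zero on starred ones, so their values at
    [unstarred_roots] determine them. *)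
Lemma leq_unstarred_roots B :
  parity_base L A B -> (k <= #|unstarred_roots B|)%N.
Proof.
move=> baseB; have [/subsetP BL _ _] := baseB.
pose M : 'M[rat]_(#|V|, #|line_set L B|) :=
  \matrix_(i, j) inc (enum_val i) (tnth L (enum_val j)).
(* Multiplying by [H] restricts a vector on the vertices to the unstarred roots; [ker0] says that
   this is injective on the left kernel of [M]. *)
pose H : 'M[rat]_(#|V|, #|unstarred_roots B|) :=
  \matrix_(i, j) (enum_val i == enum_val j :> V)%:R.
have ker0 : (kermx M :&: kermx H)%MS = 0.
  apply/eqP/rowV0P => f; rewrite sub_capmx => /andP[/sub_kermxP fM /sub_kermxP fH].
  pose phi v := f 0 (enum_rank v).
  have phi_inc e : e \in B -> \sum_v phi v * inc v e = 0.
    move=> eB; have /tnthP[t et] := BL e eB.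
    have tB : t \in line_set L B by rewrite inE -et.
    transitivity ((f *m M) 0 (enum_rank_in tB t)); last by rewrite fM mxE.
    rewrite mxE (reindex _ (onW_bij _ (@enum_val_bij V))) /=.
    apply: eq_bigr => i _; rewrite mxE enum_rankK_in // -et /phi.
    by rewrite enum_valK.
  have phi_linked v w : linked B v w -> phi v = phi w.
    apply: connect_invariant => {}v {}w; rewrite /adj /= inE => eB.
    have eE : [set v; w] \in E by have := BL _ eB; rewrite L_enum inE.
    exact: (sum_incidence_eq0 simpleE no_terminal_edge tail_end eE (phi_inc _ eB)).
  have phi0 v : phi v = 0.
    case vS: (starred B v).
      have /existsP[w /andP[/phi_linked-> wB]] := vS.
      have := phi_inc _ wB; rewrite sum_incidence_star //.
      by have := BL _ wB; rewrite L_enum inE.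
    rewrite (phi_linked _ _ (connect_root _ v)).
    set v0 := fingraph.root _ v.
    have v0R : v0 \in unstarred_roots B.
      rewrite inE; apply/andP; split; first exact/roots_root/adj_connect_sym.
      by rewrite -(starred_linked (connect_root _ v)) vS.
    have := congr1 (fun N => fun_of_matrix N 0 (enum_rank_in v0R v0)) fH.
    rewrite mxE [RHS]mxE (bigD1 (enum_rank v0)) //= big1 ?addr0.
      by rewrite mxE enum_rankK enum_rankK_in // eqxx mulr1.
    move=> i iv; rewrite mxE enum_rankK_in //; case: eqP => [e|]; last by rewrite mulr0.
    by rewrite -e enum_valK eqxx in iv.
  by apply/rowP=> i; rewrite mxE -(enum_valK i) -[LHS]/(phi _) phi0.
have := mxrank_mul_ker (kermx M) H; rewrite ker0 mxrank0 addn0 mxrank_ker => rk.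
have := rank_leq_col (kermx M *m H); rewrite rk; apply: leq_trans.
move: (\rank M) (rank_leq_col M) => rho.
rewrite (card_vertices u_uniq u_enum x_uniq x_enum) card_parity_base //.
by rewrite -addnn; lia.
Qed.

(** At least k unstarred components have at least two terminals each, and there are only 2k
    terminals, so all these bounds are equalities. [f] exchanges the two terminals of a
    component. *)
Lemma terminal_partner B : parity_base L A B ->
  exists2 f : 'I_k.*2 -> 'I_k.*2, involutive f &
    forall i, [/\ f i != i, ~~ starred B (tnth u i),
      part_of Ss (tnth u i) != part_of Ss (tnth u (f i))
      & forall j, linked B (tnth u i) (tnth u j) = (j \in [:: i; f i])].
Proof.
move=> baseB; pose e := adj (graph_part B).
have e_sym : connect_sym e by exact: adj_connect_sym.
pose cls v := [set i | fingraph.root e (tnth u i) == v].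
have clsE v i : v \in unstarred_roots B -> (i \in cls v) = linked B v (tnth u i).
  rewrite !inE => /andP[/eqP rv _]; rewrite -[in LHS]rv eq_sym.
  exact: root_connect.
have two_parts v : v \in unstarred_roots B -> exists i j,
    [/\ i \in cls v, j \in cls v & part_of Ss (tnth u i) != part_of Ss (tnth u j)].
  move=> vR; have := vR; rewrite inE => /andP[_ vS].
  have [i [j [vi vj ij]]] := component_two_parts baseB vS.
  by exists i, j; rewrite !clsE.
have card_cls v : v \in unstarred_roots B -> (2 <= #|cls v|)%N.
  move=> /two_parts[i [j [vi vj ij]]].
  have ij' : i != j by apply: contraNneq ij => ->.
  by rewrite -[2%N]/(true.+1) -ij' -cards2 subset_leq_card // subUset !sub1set vi.
(* The terminals in starred components; the count will show that there are none. *)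
pose bad := [set i | fingraph.root e (tnth u i) \notin unstarred_roots B].
have total : (\sum_(v in unstarred_roots B) #|cls v| + #|bad| = k.*2)%N.
  transitivity #|'I_k.*2|; last exact: card_ord.
  rewrite -[RHS]sum1_card [RHS](bigID (fun i =>
    fingraph.root e (tnth u i) \in unstarred_roots B)) /=.
  congr (_ + _)%N; last by rewrite -sum1_card; apply: eq_bigl => i; rewrite inE.
  rewrite [RHS](partition_big (fun i => fingraph.root e (tnth u i))
    (mem (unstarred_roots B))) //=.
  apply: eq_bigr => v vR; rewrite -sum1_card; apply: eq_bigl => i.
  by rewrite inE; case: eqP => [->|]; rewrite ?vR // andbF.
have leq_total : (k.*2 <= \sum_(v in unstarred_roots B) 2)%N.
  by rewrite sum_nat_const muln2 leq_double leq_unstarred_roots.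
(* The equality case of the summed bounds forces every class to have at most two elements. *)
have [le_sum eq_sum] := leqif_sum (fun v vR => leqif_geq (card_cls v vR)).
have sum_eq : (\sum_(v in unstarred_roots B) 2 ==
               \sum_(v in unstarred_roots B) #|cls v|)%N.
  rewrite eqn_leq le_sum (leq_trans _ leq_total) //.
  by have := leq_addr #|bad| (\sum_(v in unstarred_roots B) #|cls v|); rewrite total.
have {eq_sum} /forall_inP cls2 :
    [forall (v | v \in unstarred_roots B), (#|cls v| <= 2)%N].
  by rewrite -eq_sum.
have bad0 i : i \notin bad.
  suff /eqP/cards0_eq-> : #|bad| == 0%N by rewrite inE.
  rewrite -leqn0 -(leq_add2l (\sum_(v in unstarred_roots B) #|cls v|)) total.
  by rewrite addn0 -(eqP sum_eq).
have partner i : exists j, [/\ j != i, ~~ starred B (tnth u i),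
      part_of Ss (tnth u i) != part_of Ss (tnth u j)
      & forall j', linked B (tnth u i) (tnth u j') = (j' \in [:: i; j])].
  have := bad0 i; rewrite inE negbK; set v := fingraph.root _ _ => vR.
  have vi : linked B v (tnth u i) by rewrite linked_sym connect_root.
  have [i1 [i2 [vi1 vi2 i12]]] := two_parts v vR.
  have ne12 : i1 != i2 by apply: contraNneq i12 => ->.
  have cls12 : cls v = [set i1; i2].
    apply/esym/eqP; rewrite eqEcard subUset !sub1set vi1 vi2 /=.
    by rewrite cards2 ne12 cls2.
  have linkE j : linked B (tnth u i) (tnth u j) = (j \in [set i1; i2]).
    by rewrite -cls12 clsE // -(same_connect e_sym vi).
  have iS : ~~ starred B (tnth u i).
    by rewrite -(starred_linked vi); have := vR; rewrite inE => /andP[].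
  have : i \in [set i1; i2] by rewrite -cls12 clsE.
  rewrite !inE => /orP[]/eqP e_i.
    exists i2; rewrite e_i eq_sym ne12 -e_i; split=> // [|j]; first by rewrite e_i.
    by rewrite linkE !inE e_i.
  exists i1; rewrite e_i ne12 -e_i; split=> // [|j]; first by rewrite e_i eq_sym.
  by rewrite linkE !inE e_i orbC.
have [f fP] := fin_all_exists partner.
exists f => // i; have [fi _ _ linkE] := fP i; have [_ _ _ linkE'] := fP (f i).
have : linked B (tnth u (f i)) (tnth u i).
  by rewrite linked_sym linkE !inE eqxx orbT.
by rewrite linkE' !inE (eq_sym i) (negPf fi) => /eqP<-.
Qed.

End Components.

(** * The determinant of a parity base *)

Lemma det_col_mxN (p q : 'rV[rat]_2) :
  \det (\matrix_(i, j) if i == 0 then - p 0 j else q 0 j) =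
  - \det (col_mx p q : 'M_2).
Proof.
rewrite -mulN1r -[RHS]addr0 -[X in _ + X](mul0r (\det (col_mx p q : 'M_2))).
apply: (determinant_multilinear (i0 := ord0)).
- apply/rowP=> j; rewrite !mxE eqxx mul0r addr0 mulN1r.
  by case: splitP => // i _; rewrite ord1.
- apply/matrixP=> i j; rewrite !mxE eq_sym (negPf (neq_lift _ _)).
  by case: splitP => a; rewrite (ord1 a).
- apply/matrixP=> i j; rewrite !mxE eq_sym (negPf (neq_lift _ _)).
  by case: splitP => a; rewrite (ord1 a).
Qed.

Section Determinant.

Variables (V : finType) (E : {set {set V}}) (Ss : 'I_3 -> {set V}).
Variables (k n m : nat) (u : k.*2.-tuple V) (x : n.-tuple V).
Variables (L : m.-tuple ({set V} + V)%type).
Variables (b : 'I_3 -> 'rV[rat]_2) (tail : {set V} -> V).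
Hypothesis simpleE : simple_edges E.
Hypothesis no_terminal_edge : forall e, e \in E -> ~~ (e \subset terminals Ss).
Hypothesis (u_uniq : uniq u) (u_enum : u =i terminals Ss).
Hypothesis (x_uniq : uniq x) (x_enum : x =i ~: terminals Ss).
Hypothesis L_enum : L =i star_edges E Ss.
Hypothesis tail_end :
  forall e, e \in E -> e \subset ~: terminals Ss -> tail e \in e.

Notation A := (stu_matrix Ss u b tail x L).
Notation inc := (incidence Ss tail).
Notation linked B := (connect (adj (graph_part B))).
Implicit Types (B : {set {set V} + V}) (s : 'S_(k.*2)).

(** Taking the rows in the order of [s] makes the matrix block diagonal; the negated first row of
    each block gives one factor -1, and the reordering costs [sgn s]. *)
Lemma det_terminal_pairs s :
  \det (\matrix_(i, j < k.*2)
    (((s (hi (pair_of j)) == i)%:R - (s (lo (pair_of j)) == i)%:R)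
      * b (part_of Ss (tnth u i)) 0 (coord_of j)))
  = (-1) ^+ k * (c_path Ss u b s * sgn s).
Proof.
set Y := (X in \det X).
have : \det (row_perm s Y) = (-1) ^+ k * c_path Ss u b s.
  pose D (a : 'I_k) : 'M[rat]_2 := \matrix_(c, c')
    if c == 0 then - b (part_of Ss (tnth u (s (lo a)))) 0 c'
    else b (part_of Ss (tnth u (s (hi a)))) 0 c'.
  have -> : row_perm s Y = \matrix_(i, j < k.*2)
      (D (pair_of i) (coord_of i) (coord_of j) *+ (pair_of i == pair_of j)).
    apply/matrixP=> i j; rewrite !mxE !(inj_eq perm_inj).
    have [[a ->]|[a ->]] := lohiP i.
      rewrite pair_of_lo coord_of_lo eqxx (eq_sym (hi _)) lo_neq_hi.
      rewrite (inj_eq (@lo_inj _)) eq_sym.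
      by case: eqP => [->|_]; rewrite ?mulr1n ?sub0r ?mulN1r ?subrr ?mul0r.
    rewrite pair_of_hi coord_of_hi lo_neq_hi (inj_eq (@hi_inj _)) eq_sym.
    by case: eqP => [->|_]; rewrite ?mulr1n ?subr0 ?mul1r ?mul0r.
  rewrite det_pairs /c_path -[X in _ ^+ X](card_ord k) -prodrN.
  by apply: eq_bigr => a _; rewrite det_col_mxN.
rewrite row_permE det_mulmx det_perm => sY.
have -> : \det Y = (-1) ^+ s * ((-1) ^+ s * \det Y).
  by rewrite mulrA -expr2 sqrr_sign mul1r.
by rewrite sY mulrC -mulrA.
Qed.

(** Over the lines of [B] the incidence rows of an unstarred component sum to zero, which expresses
    the second terminal of a pair through the rest. The determinant of [Z] enters squared, so [tail]
    and the orders of [x] and [L] leave no trace. *)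
Lemma det_parity_base B s :
    parity_base L A B ->
    (forall i, ~~ starred B (tnth u i)) ->
    (forall i j, linked B (tnth u (s (hi i))) (tnth u j)
                 = (j \in [:: s (lo i); s (hi i)])) ->
  \det (sub_lines L A B) = (-1) ^+ k * (c_path Ss u b s * sgn s).
Proof.
move=> baseB unstarred paired; have [BL _ det_neq0] := baseB.
have cardB := card_parity_base baseB.
have eqN : (k.*2 + n.*2 = (k + n).*2)%N by rewrite doubleD.
have eqN' : (k.*2 + n.*2 = #|line_set L B|.*2)%N by rewrite cardB.
(* The rows of [Z] belong to the first terminal of each pair and to all inner vertices, which makes
   [Z] square. *)
pose vert (i : 'I_(k + n)) : V :=
  match split i with inl a => tnth u (s (lo a)) | inr a => tnth x a end.
have vertl a : vert (lshift n a) = tnth u (s (lo a)).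
  by rewrite /vert (unsplitK (inl _)).
have vertr a : vert (rshift k a) = tnth x a.
  by rewrite /vert (unsplitK (inr _)).
pose ln (j : 'I_(k + n)) := tnth L (enum_val (cast_ord (esym cardB) j)).
have lnB j : ln j \in B.
  by have := enum_valP (cast_ord (esym cardB) j); rewrite inE.
pose Z : 'M[rat]_(k + n) := \matrix_(i, j) inc (vert i) (ln j).
pose D := mxsub (cast_ord eqN) (cast_ord eqN) (doubled Z).
pose bu i c := b (part_of Ss (tnth u i)) 0 c.
(* Coefficients of the negated incidence row of terminal [i] over the rows of [Z]: minus its own row
   for a first terminal; the row of the partner plus the inner rows of the component for a second
   one, recognized by the parity of its position in [s]. *)
pose alpha i (a : 'I_k) : rat := (s (hi a) == i)%:R - (s (lo a) == i)%:R.
pose gamma i a : rat :=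
  (odd ((s^-1)%g i) && linked B (tnth u i) (tnth x a))%:R.
pose Y : 'M[rat]_(k.*2 + n.*2) := block_mx
  (\matrix_(i, j) (alpha i (pair_of j) * bu i (coord_of j)))
  (\matrix_(i, j) (gamma i (pair_of j) * bu i (coord_of j))) 0 1%:M.
have vert_inj : injective vert.
  have inu := tnth_u_terminal u_enum; have inx := tnth_x_inner x_enum.
  move=> i j; case: (split_ordP i) => a ->; case: (split_ordP j) => c ->;
    rewrite ?vertl ?vertr.
  - by move/(elimT (tuple_uniqP u) u_uniq)/perm_inj/lo_inj->.
  - by move=> e; have := inx c; rewrite -e inu.
  - by move=> e; have := inx a; rewrite e inu.
  - by move/(elimT (tuple_uniqP x) x_uniq)->.
have subE : sub_lines L A B = Y *m D.
  apply/matrixP=> i j; rewrite (sub_linesE A eqN').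
  set j' := line_cols _; set c := coord_of (cast_ord eqN j).
  set e := ln (pair_of (cast_ord eqN j)).
  have ej : tnth L (pair_of j') = e.
    rewrite pair_of_line_cols /e /ln; congr (tnth _ (enum_val _)).
    exact: val_inj.
  have cj : coord_of j' = c by rewrite coord_of_line_cols.
  have DE r : D r j = inc (vert (pair_of (cast_ord eqN r))) e *+
      (coord_of (cast_ord eqN r) == c) by rewrite !mxE.
  have Dl (r : 'I_k.*2) : D (lshift _ r) j =
      inc (tnth u (s (lo (pair_of r)))) e *+ (coord_of r == c).
    rewrite DE -vertl; congr (inc (vert _) _ *+ _); exact: val_inj.
  have Dr (r : 'I_n.*2) : D (rshift _ r) j =
      inc (tnth x (pair_of r)) e *+ (coord_of r == c).
    rewrite DE -vertr.
    have -> : pair_of (cast_ord eqN (rshift k.*2 r)) = rshift k (pair_of r).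
      by apply: val_inj; rewrite /= halfD odd_double /= doubleK.
    by rewrite /coord_of /= oddD odd_double.
  (* Of each pair of indices only the one with coordinate [c] contributes, which leaves a scalar
     sum. *)
  have coord_sum N (f : 'I_N -> rat) g (h : 'I_N -> rat) :
      \sum_(r < N.*2) f (pair_of r) * g (coord_of r)
         * (h (pair_of r) *+ (coord_of r == c)) = (\sum_a f a * h a) * g c.
    rewrite big_lohi mulr_suml; apply: eq_bigr => a _.
    rewrite !pair_of_lo !pair_of_hi coord_of_lo coord_of_hi.
    case: c {DE Dl Dr cj} => [[|[|//]] lt] /=.
      rewrite mulr1n mulr0n mulr0 addr0 mulrAC; congr (_ * _ * g _).
      exact: val_inj.
    rewrite mulr1n mulr0n mulr0 add0r mulrAC; congr (_ * _ * g _).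
    exact: val_inj.
  rewrite [RHS]mxE big_split_ord /=.
  case: (split_ordP i) => i' -> {i}; last first.
    rewrite big1 ?add0r => [|r _]; last by rewrite block_mxEdl mxE mul0r.
    rewrite (bigD1 i') //= big1 ?addr0 => [|r /negPf ne]; last first.
      by rewrite block_mxEdr mxE eq_sym ne mul0r.
    rewrite Dr col_mxEd [LHS]mxE block_mxEdr [X in X * _]mxE eqxx mul1r ej cj.
    by rewrite inner_block_incidence ?(tnth_x_inner x_enum) // mxE.
  rewrite col_mxEu mxE (terminal_block_incidence tail); last first.
    exact: (tnth_u_terminal u_enum).
  rewrite ej cj mxE.
  under eq_bigr do rewrite block_mxEul mxE Dl.
  under [X in _ + X]eq_bigr do rewrite block_mxEur mxE Dr.
  rewrite (coord_sum _ _ _ (fun a => inc (tnth u (s (lo a))) e)).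
  rewrite (coord_sum _ _ _ (fun a => inc (tnth x a) e)) -mulrDl; congr (_ * _).
  have [r {i'}->] : exists r, i' = s r by exists ((s^-1)%g i'); rewrite permKV.
  rewrite /alpha /gamma permK; under eq_bigr do rewrite !(inj_eq perm_inj).
  have [[a ->]|[a ->]] := lohiP r.
    rewrite (bigD1 a) //= big1 => [|a' ne]; last first.
      by rewrite eq_sym lo_neq_hi (inj_eq (@lo_inj _)) (negPf ne) subrr mul0r.
    rewrite eqxx eq_sym lo_neq_hi sub0r mulN1r odd_double /= big1 ?addr0 //.
    by move=> a' _; rewrite mul0r.
  rewrite (bigD1 a) //= big1 => [|a' ne]; last first.
    by rewrite lo_neq_hi (inj_eq (@hi_inj _)) (negPf ne) subrr mul0r.
  rewrite eqxx lo_neq_hi !subr0 mul1r odd_double /=.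
  (* For a second terminal, the zero sum over its component is solved for its own incidence. *)
  have := component_incidence_sum simpleE no_terminal_edge L_enum tail_end BL
    (lnB (pair_of (cast_ord eqN j))) (unstarred (s (hi a))).
  rewrite (sum_vertices u_uniq u_enum x_uniq x_enum) -/e.
  rewrite (bigD1 (s (lo a))) //= (bigD1 (s (hi a))) /=; last first.
    by rewrite (inj_eq perm_inj) eq_sym lo_neq_hi.
  rewrite big1 ?addr0 => [|i /andP[/negPf ne1 /negPf ne2]]; last first.
    by rewrite paired !inE ne1 ne2 mul0r.
  rewrite !paired !inE !eqxx orbT !mul1r addrAC => /eqP.
  by rewrite addr_eq0 => /eqP->.
have detY : \det Y = (-1) ^+ k * (c_path Ss u b s * sgn s).
  by rewrite det_ublock det1 mulr1 -det_terminal_pairs.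
have detD : \det D = \det Z ^+ 2.
  rewrite det_reindex ?det_doubled //.
  by exists (cast_ord (esym eqN)); [exact: cast_ordK | exact: cast_ordKV].
rewrite subE det_mulmx detY detD det_incidence ?mulr1 // => [i j|i i' j|].
- by rewrite mxE incidence_entry.
- rewrite !mxE => eq_ii' neq0; apply: vert_inj.
  apply: (incidence_inj simpleE no_terminal_edge tail_end) eq_ii' neq0.
  by rewrite -L_enum (subsetP BL).
- by apply: contraNneq det_neq0 => Z0; rewrite subE det_mulmx detD Z0 expr0n mulr0.
Qed.

End Determinant.

(** * Edge sets of paths *)

Section PathEdges.

Variable V : finType.
Implicit Types (G : {set {set V}}) (v w : V) (p : seq V).

Lemma path_edges_cons v w p :
  path_edges v (w :: p) = [set v; w] |: path_edges w p.
Proof. by apply/setP=> e; rewrite !inE. Qed.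

Lemma path_edges_sub G v p : (path_edges v p \subset G) = path (adj G) v p.
Proof.
elim: p v => [|w p IHp] v /=; first by apply/subsetP=> e; rewrite inE.
by rewrite path_edges_cons subUset sub1set IHp.
Qed.

Lemma mem_path_edges v p e w : e \in path_edges v p -> w \in e -> w \in v :: p.
Proof.
elim: p v => [|z p IHp] v; first by rewrite inE.
rewrite path_edges_cons in_setU1 => /orP[/eqP->|ep we].
  by rewrite !inE orbA => ->.
by have := IHp _ ep we; rewrite [in X in _ -> X]inE => ->; rewrite orbT.
Qed.

Lemma card_path_edges v p : (#|path_edges v p| <= size p)%N.
Proof.
rewrite cardsE (leq_trans (card_size _)) // size_map size_zip /=.
by rewrite (minn_idPr (leqnSn _)).
Qed.

(** A path reduced to one vertex is excluded, as it has no edge to cover that vertex. *)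
Lemma cover_path_edges v p w :
  p != [::] -> w \in v :: p -> w \in cover (path_edges v p).
Proof.
elim: p v => [//|z p IHp] v _.
rewrite path_edges_cons /cover bigcup_setU big_set1 2!in_cons inE => /or3P[].
- by move/eqP->; rewrite set21.
- by move/eqP->; rewrite set22.
move=> wp; apply/orP; right; apply: IHp; last by rewrite inE wp orbT.
by case: p wp.
Qed.

End PathEdges.

(** * Independence of [c_path] from the pairing *)

Section Pairings.

Variables (V : finType) (Ss : 'I_3 -> {set V}).
Variables (k : nat) (u : k.*2.-tuple V) (b : 'I_3 -> 'rV[rat]_2).
Hypothesis u_sorted : forall i j : 'I_k.*2, (i <= j)%N ->
  (part_of Ss (tnth u i) <= part_of Ss (tnth u j))%N.
Implicit Type s : 'S_(k.*2).

Notation pt i := (part_of Ss (tnth u i)).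

Definition det_without (c : 'I_3) : rat :=
  \det (col_mx (b (lift c (0 : 'I_2))) (b (lift c (1 : 'I_2))) : 'M_2).

(** Only the factor of the third part survives. A product over all [c] can be exchanged with the
    product over the pairs. *)
Lemma b_pairE (a a' : 'I_3) : (a < a')%N ->
  \det (col_mx (b a) (b a') : 'M_2) =
  \prod_c det_without c ^+ ((c != a) && (c != a')).
Proof.
move=> lt_aa'; rewrite !big_ord_recl big_ord0 mulr1 /det_without.
case: a a' lt_aa' => [[|[|[|//]]] lta] [[|[|[|//]]] lta'] //= _;
  rewrite ?expr1 ?expr0 ?mul1r ?mulr1;
  by congr (\det (col_mx (b _) (b _))); apply: val_inj.
Qed.

(* Every pair misses exactly one of the three parts, so the number of pairs
   missing a given part is determined by the size of that part. *)
Lemma c_pathE s : F2k s -> (forall i, pt (s (lo i)) != pt (s (hi i))) ->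
  c_path Ss u b s =
  \prod_c det_without c ^+ (k - \sum_i (c == pt i)).
Proof.
move=> [_ lt_lohi] pt_neq; rewrite /c_path /det2.
(* Sorted terminals and [F2k] fix the order of the two parts in each pair, so no determinant changes
   sign between pairings. *)
have lt_pt i : (pt (s (lo i)) < pt (s (hi i)))%N.
  by rewrite ltn_neqAle u_sorted ?(ltnW (lt_lohi i)) // pt_neq.
rewrite (eq_bigr _ (fun i _ => b_pairE (lt_pt i))).
rewrite exchange_big /=; apply: eq_bigr => c _.
rewrite prodrXr; congr (_ ^+ _).
rewrite [in RHS](reindex_inj (@perm_inj _ s)) big_lohi /=.
apply: (canRL (addnK _)); rewrite -big_split /=.
transitivity (\sum_(i < k) 1)%N; last by rewrite sum_nat_const card_ord muln1.
apply: eq_bigr => i _; have /negPf ne := pt_neq i.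
case: (eqVneq c (pt (s (lo i)))) => [->|_] /=; first by rewrite ne.
by case: eqP.
Qed.

Lemma c_path_neq0 s :
    (forall a a', a != a' -> row_free (col_mx (b a) (b a'))) ->
    (forall i, pt (s (lo i)) != pt (s (hi i))) ->
  c_path Ss u b s != 0.
Proof.
move=> b_indep pt_neq; apply/prodf_neq0 => i _.
rewrite -unitfE -[_ \is a GRing.unit]/(_ \in unitmx) -row_free_unit.
exact: b_indep.
Qed.

End Pairings.

(** * From parity bases to disjoint paths *)

Section BasesAndPaths.

Variables (V : finType) (E : {set {set V}}) (Ss : 'I_3 -> {set V}).
Variables (k n m : nat) (u : k.*2.-tuple V) (x : n.-tuple V).
Variables (L : m.-tuple ({set V} + V)%type).
Variables (b : 'I_3 -> 'rV[rat]_2) (tail : {set V} -> V).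
Hypothesis simpleE : simple_edges E.
Hypothesis no_terminal_edge : forall e, e \in E -> ~~ (e \subset terminals Ss).
Hypothesis (u_uniq : uniq u) (u_enum : u =i terminals Ss).
Hypothesis (x_uniq : uniq x) (x_enum : x =i ~: terminals Ss).
Hypothesis (L_uniq : uniq L) (L_enum : L =i star_edges E Ss).
Hypothesis
  b_indep : forall a a', a != a' -> row_free (col_mx (b a) (b a')).
Hypothesis tail_end :
  forall e, e \in E -> e \subset ~: terminals Ss -> tail e \in e.

Notation A := (stu_matrix Ss u b tail x L).
Notation inc := (incidence Ss tail).
Notation linked B := (connect (adj (graph_part B))).
Implicit Types (B : {set {set V} + V}) (P : {set {set V}}) (s : 'S_(k.*2)).

Lemma graph_part_sub B : B \subset L -> graph_part B \subset E.
Proof.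
by move/subsetP=> BL; apply/subsetP=> e; rewrite inE => /BL; rewrite L_enum inE.
Qed.

Lemma parity_base_path B : parity_base L A B ->
  exists P s, [/\ stu_path_perm E Ss u P s, P \subset graph_part B &
    \det (sub_lines L A B) = (-1) ^+ k * (c_path Ss u b s * sgn s)].
Proof.
move=> baseB; have [BL _ _] := baseB.
have [f fK fP] := terminal_partner simpleE no_terminal_edge u_uniq u_enum x_uniq
  x_enum L_enum b_indep tail_end baseB.
have [s sF sf] := F2k_of_involution fK (fun i => let: And4 h _ _ _ := fP i in h).
have linkE i j : linked B (tnth u i) (tnth u j) = (j \in [:: i; f i]).
  by have [] := fP i.
have path_exists i : exists p,
    [/\ path (adj (graph_part B)) (tnth u (s (lo i))) p,
        uniq (tnth u (s (lo i)) :: p) &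
        last (tnth u (s (lo i))) p = tnth u (s (hi i))].
  have : linked B (tnth u (s (lo i))) (tnth u (s (hi i))).
    by rewrite linkE sf !inE eqxx orbT.
  case/connectP=> p /shortenP[p' path_p' uniq_p' _] ->.
  by exists p'.
have [p pP] := fin_all_exists path_exists.
exists (\bigcup_i path_edges (tnth u (s (lo i))) (p i)), s; split.
- split=> //; exists p; split=> // i.
  + have [path_p uniq_p last_p] := pP i; rewrite /is_path uniq_p last_p eqxx !andbT.
    by rewrite -path_edges_sub (subset_trans _ (graph_part_sub BL)) // path_edges_sub.
  + by rewrite -sf; have [] := fP (s (lo i)).
  (* A common vertex would link the first terminals of two pairs. *)
  + move=> j ij; rewrite disjoint_subset; apply/subsetP=> v vi.
    rewrite inE; apply/negP=> vj; case/eqP: ij.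
    have [pi _ _] := pP i; have [pj _ _] := pP j.
    have := path_connect pj vj; rewrite linked_sym.
    move/(connect_trans (path_connect pi vi)); rewrite linkE sf !inE.
    by rewrite !(inj_eq perm_inj) lo_neq_hi orbF => /eqP/lo_inj->.
- apply/bigcupsP=> i _; rewrite path_edges_sub.
  by have [] := pP i.
- apply: (det_parity_base simpleE no_terminal_edge u_uniq u_enum x_uniq x_enum
    L_enum tail_end baseB) => [i|i j]; first by have [] := fP i.
  by rewrite linkE -sf fK !inE orbC.
Qed.

Definition star_completion P : {set {set V} + V} :=
  [set e | match e with inl e => e \in P | inr v => v \notin cover P end].

Lemma graph_part_completion P : graph_part (star_completion P) = P.
Proof. by apply/setP=> e; rewrite !inE. Qed.

(** * From disjoint paths to parity bases *)

Section StuPath.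

Variables (P : {set {set V}}) (s : 'S_(k.*2)) (p : 'I_k -> seq V).
Let start i := tnth u (s (lo i)).
Let finish i := tnth u (s (hi i)).
Hypothesis path_p : forall i, is_path E (start i) (p i) (finish i).
Hypothesis parts_p : forall i, part_of Ss (start i) != part_of Ss (finish i).
Hypothesis disjoint_p :
  forall i j, i != j -> [disjoint start i :: p i & start j :: p j].
Hypothesis P_def : P = \bigcup_i path_edges (start i) (p i).

Lemma stu_path_edges : P \subset E.
Proof.
rewrite P_def; apply/bigcupsP=> i _; rewrite path_edges_sub.
by have /and3P[] := path_p i.
Qed.

Lemma path_vertex_cover i v : v \in start i :: p i -> v \in cover P.
Proof.
move=> vi; have : v \in cover (path_edges (start i) (p i)).
  (* The ends lie in distinct parts, so the path has an edge. *)
  apply: cover_path_edges => //; apply: contraNneq (parts_p i) => p0.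
  by have /and3P[_ _ /eqP <-] := path_p i; rewrite p0.
case/bigcupP=> e ei ve; apply/bigcupP; exists e => //.
by rewrite P_def; apply/bigcupP; exists i.
Qed.

Lemma cover_path_vertex v : v \in cover P -> exists i, v \in start i :: p i.
Proof.
case/bigcupP=> e; rewrite P_def => /bigcupP[i _ ei] ve.
by exists i; apply: mem_path_edges ei ve.
Qed.

Lemma connect_path_vertex i v : v \in start i :: p i -> connect (adj P) (start i) v.
Proof.
apply: path_connect; rewrite -path_edges_sub P_def; exact: bigcup_sup.
Qed.

Lemma finish_path_vertex i : finish i \in start i :: p i.
Proof. by have /and3P[_ _ /eqP <-] := path_p i; rewrite mem_last. Qed.

Lemma terminal_path_vertex j : exists i, tnth u j \in start i :: p i.
Proof.
rewrite -(permKV s j); have [[i ->]|[i ->]] := lohiP ((s^-1)%g j); exists i.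
  by rewrite mem_head.
exact: finish_path_vertex.
Qed.

(** With d the sum of the [size (p i)], the set [P] has at most d edges and covers at least d + k of
    the 2k + n vertices, so at most n + k - d star lines are added. *)
Lemma card_star_completion : (#|star_completion P| <= k + n)%N.
Proof.
have subset_sum :
    star_completion P \subset (inl @: P) :|: (inr @: ~: cover P).
  apply/subsetP=> -[e|v]; rewrite !inE => ?; apply/orP;
    by [left; apply: imset_f | right; apply: imset_f; rewrite inE].
have := subset_leq_card subset_sum; move/leq_trans; apply.
apply: leq_trans (leq_card_setU _ _) _.
rewrite !card_imset; [|by move=> ? ? []..].
have cardP : (#|P| <= \sum_i size (p i))%N.
  rewrite P_def; apply: (@leq_trans (\sum_i #|path_edges (start i) (p i)|)).
    elim/big_rec2: _ => [|i c U _ IH]; first by rewrite cards0.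
    by apply: leq_trans (leq_card_setU _ _) _; rewrite leq_add2l.
  by apply: leq_sum => i _; exact: card_path_edges.
have cardW : (\sum_i (size (p i) + 1) <= #|cover P|)%N.
  pose W := \bigcup_i [set v in start i :: p i].
  have <- : #|W| = (\sum_i (size (p i) + 1))%N.
    rewrite -sum1_card partition_disjoint_bigcup => [|i j ij].
      apply: eq_bigr => i _; rewrite sum1_card cardsE.
      by have /and3P[_ /card_uniqP -> _] := path_p i; rewrite /= addn1.
    have := disjoint_p ij; rewrite -!setI_eq0 => /pred0P dij.
    by apply/eqP/setP=> v; rewrite !inE; have := dij v; rewrite /= !inE.
  apply: subset_leq_card; apply/bigcupsP=> i _; apply/subsetP=> v.
  rewrite inE; exact: path_vertex_cover.
have := cardsC (cover P); have := card_vertices u_uniq u_enum x_uniq x_enum.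
move: cardW; rewrite big_split /= sum_nat_const card_ord muln1 -addnn.
by move: cardP; move: #|P| #|cover P| #|~: cover P| #|V| (\sum_i _)%N => *; lia.
Qed.

(** No star line is placed at a terminal, because every terminal is an end of some path. *)
Lemma star_completion_sub : star_completion P \subset L.
Proof.
apply/subsetP=> -[e|v]; rewrite L_enum !inE; first exact/subsetP/stu_path_edges.
apply: contra; rewrite -u_enum => /tnthP[j ->].
by have [i] := terminal_path_vertex j; exact: path_vertex_cover.
Qed.

(** A potential killed by these lines vanishes off [P] because of the star lines and is constant
    along each path, where the values at the two ends are multiples of independent vectors, hence
    zero. *)
Lemma star_completion_base : parity_base L A (star_completion P).
Proof.
apply: parity_base_of_ker.
- exact: star_completion_sub.
- rewrite card_columns (card_line_set L_uniq star_completion_sub) -doubleD leq_double.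
  exact: card_star_completion.
move=> r r0; pose z c v := potential Ss u x b r c v.
have z_line c e : e \in star_completion P -> \sum_v z c v * inc v e = 0.
  move=> eC; have /tnthP[t et] := subsetP star_completion_sub _ eC.
  have [pt ct] : pair_of (lohi (t, c != 0)) = t /\ coord_of (lohi (t, c != 0)) = c.
    case: c => [[|[|//]] lt]; rewrite /lohi /= ?pair_of_lo ?pair_of_hi.
      by rewrite coord_of_lo; split=> //; exact: val_inj.
    by rewrite coord_of_hi; split=> //; exact: val_inj.
  have := r0 (lohi (t, c != 0)); rewrite inE pt -et => /(_ eC).
  by rewrite (mul_stu_matrix _ _ _ u_uniq u_enum x_uniq x_enum) pt ct -et.
have z_adj c v w : connect (adj P) v w -> z c v = z c w.
  apply: connect_invariant => {}v {}w; rewrite /adj /= => eP.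
  have eC : inl [set v; w] \in star_completion P by rewrite inE.
  have eE := subsetP stu_path_edges _ eP.
  exact: (sum_incidence_eq0 simpleE no_terminal_edge tail_end eE (z_line c _ eC)).
have r_ends i : r 0 (lshift _ (s (lo i))) *: b (part_of Ss (start i)) =
                r 0 (lshift _ (s (hi i))) *: b (part_of Ss (finish i)).
  apply/rowP=> c; rewrite !mxE; apply: oppr_inj.
  have zu j : - (r 0 (lshift n.*2 j) * b (part_of Ss (tnth u j)) 0 c) =
      z c (tnth u j) by rewrite /z potential_u.
  rewrite !zu.
  exact/z_adj/connect_path_vertex/finish_path_vertex.
have r_terminal j : r 0 (lshift _ j) = 0.
  rewrite -(permKV s j); have [[i ->]|[i ->]] := lohiP ((s^-1)%g j).
    by apply: b_indep_eq0 (r_ends i); rewrite ?parts_p.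
  by apply: b_indep_eq0 (esym (r_ends i)); rewrite // eq_sym parts_p.
have z0 c v : z c v = 0.
  have [vP|vP] := boolP (v \in cover P); last first.
    have vC : inr v \in star_completion P by rewrite inE.
    rewrite -(z_line c _ vC) sum_incidence_star //.
    by have := subsetP star_completion_sub _ vC; rewrite L_enum inE.
  have [i /connect_path_vertex/z_adj <-] := cover_path_vertex vP.
  by rewrite /z potential_u // r_terminal mul0r oppr0.
apply/rowP=> i; rewrite [RHS]mxE; case: (split_ordP i) => j -> //.
(* The inner entries of [r] are coordinates of the potential, selected by the parity of the
   index. *)
rewrite -(lohi_of_pair j); have := z0 (if odd j then 1 else 0) (tnth x (pair_of j)).
by rewrite /z (potential_x _ u_enum x_uniq x_enum); case: (odd j).
Qed.

(** Each vertex of [P] is linked in [B] to a terminal, and components of terminals carry no star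
    line. *)
Lemma star_base_notin_cover B v : parity_base L A B -> P \subset graph_part B ->
  inr v \in B -> v \notin cover P.
Proof.
move=> baseB PB vB; apply/negP=> /cover_path_vertex[i /connect_path_vertex vi].
have [f _ fP] := terminal_partner simpleE no_terminal_edge u_uniq u_enum x_uniq
  x_enum L_enum b_indep tail_end baseB.
have [_ /existsPn/(_ v) + _ _] := fP (s (lo i)); rewrite vB andbT => /negP; apply.
apply: connect_sub vi => w w'; rewrite /adj /= => /(subsetP PB) ww'.
exact: connect1.
Qed.

End StuPath.

Lemma stu_path_perm_neq0 P s : stu_path_perm E Ss u P s -> c_path Ss u b s != 0.
Proof. by case=> _ [p [_ parts_p _ _]]; apply: c_path_neq0. Qed.

Lemma stu_path_base P : stu_path E Ss u P -> parity_base L A (star_completion P).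
Proof.
by case=> s [_ [p [path_p parts_p disjoint_p dP]]];
  apply: (star_completion_base path_p parts_p disjoint_p dP).
Qed.

(** The star lines of [B] avoid the path, so [B] lies in the completion; both bases have k + n
    lines. *)
Lemma parity_base_completion B : parity_base L A B ->
  stu_path E Ss u (graph_part B) -> B = star_completion (graph_part B).
Proof.
move=> baseB pathB; have baseC := stu_path_base pathB.
have [BL _ _] := baseB; have [CL _ _] := baseC.
apply/eqP; rewrite eqEcard -!(card_line_set L_uniq) //.
rewrite (card_parity_base baseB) (card_parity_base baseC) leqnn andbT.
apply/subsetP=> -[e|v] eB; rewrite !inE //.
have [s [_ [p [_ _ _ dP]]]] := pathB.
exact: (star_base_notin_cover dP baseB (subxx _) eB).
Qed.

(** * Minimum weight against minimum length *)

Section Weights.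

Variables (R : realFieldType) (l : {set V} -> R).
Hypothesis l_gt0 : forall e, e \in E -> 0 < l e.

Lemma star_weight_sum B :
  \sum_(e in B) star_weight l e = \sum_(e in graph_part B) l e.
Proof.
rewrite big_sumType /= [X in _ + X]big1 ?addr0 //.
by apply: eq_bigl => e; rewrite inE.
Qed.

(** [B] contains a disjoint path whose completion is also a base; any further edge of [B] has
    positive length and would make [B] heavier. *)
Lemma min_weight_base_path B :
  min_weight_base L A (star_weight l) B -> stu_path E Ss u (graph_part B).
Proof.
move=> [baseB minB]; have [BL _ _] := baseB.
have [P [s [pathP PB _]]] := parity_base_path baseB.
have stuP : stu_path E Ss u P by exists s.
have := minB _ (stu_path_base stuP).
rewrite !star_weight_sum graph_part_completion.
rewrite (big_setID P) /= (setIidPr PB) gerDl => le0.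
suff -> : graph_part B = P by [].
apply/eqP; rewrite eqEsubset PB andbT -setD_eq0; apply: contraTT le0.
case/set0Pn=> e eD; rewrite -ltNge (bigD1 e) //=.
have gtD e' : e' \in graph_part B :\: P -> 0 < l e'.
  by rewrite inE => /andP[_ /(subsetP (graph_part_sub BL))/l_gt0].
by apply: ltr_wpDr (gtD e eD); apply: sumr_ge0 => e' /andP[/gtD/ltW].
Qed.

Lemma min_weight_base_shortest B :
  min_weight_base L A (star_weight l) B -> shortest_stu_path E Ss u l (graph_part B).
Proof.
move=> minB; split; first exact: min_weight_base_path minB.
move=> P' /stu_path_base baseP'; have [_ /(_ _ baseP')] := minB.
by rewrite !star_weight_sum graph_part_completion.
Qed.

(** Every base contains a disjoint path and weighs at least its length. *)
Lemma shortest_min_weight_base P : shortest_stu_path E Ss u l P ->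
  min_weight_base L A (star_weight l) (star_completion P).
Proof.
move=> [pathP minP]; split=> [|B' baseB']; first exact: stu_path_base.
have [P' [s [pathP' PB' _]]] := parity_base_path baseB'; have [BL _ _] := baseB'.
rewrite !star_weight_sum graph_part_completion.
have /minP/le_trans : stu_path E Ss u P' by exists s.
apply; rewrite [leRHS](big_setID P') /= (setIidPr PB') lerDl.
apply: sumr_ge0 => e; rewrite inE => /andP[_ /(subsetP (graph_part_sub BL))].
by move/l_gt0/ltW.
Qed.

End Weights.

End BasesAndPaths.

Theorem theorem4p13
  (V : finType) (E : {set {set V}}) (Ss : 'I_3 -> {set V})
  (k n m : nat) (u : k.*2.-tuple V) (x : n.-tuple V)
  (L : m.-tuple ({set V} + V)%type)
  (b : 'I_3 -> 'rV[rat]_2) (tail : {set V} -> V)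
  (simpleE : simple_edges E)
  (Ss_neq0 : forall a, Ss a != set0)
  (Ss_disj : forall a a', a != a' -> [disjoint Ss a & Ss a'])
  (no_terminal_edge : forall e, e \in E -> ~~ (e \subset terminals Ss))
  (* u lists the terminals: first S, then T, then U *)
  (u_uniq : uniq u) (u_enum : u =i terminals Ss)
  (u_sorted : forall i j : 'I_k.*2, (i <= j)%N ->
     (part_of Ss (tnth u i) <= part_of Ss (tnth u j))%N)
  (* x and L list the non-terminals and the lines in an arbitrary order *)
  (x_uniq : uniq x) (x_enum : x =i ~: terminals Ss)
  (L_uniq : uniq L) (L_enum : L =i star_edges E Ss)
  (b_indep : forall a a', a != a' -> row_free (col_mx (b a) (b a')))
  (tail_end : forall e, e \in E -> e \subset ~: terminals Ss -> tail e \in e) :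
  let A := stu_matrix Ss u b tail x L in
  (* the sign (-1) ^+ k: along a path from x to y, eliminating the inner
     vertices leaves the rows b_x and - b_y, so each of the k paths contributes
     - det (b_x; b_y) *)
  (lgv_position E Ss u ->
   forall P s, stu_path_perm E Ss u P s ->
     pfaffian_parity L A ((-1) ^+ k * (c_path Ss u b s * sgn s)))
  /\
  (forall (R : realFieldType) (l : {set V} -> R),
     (forall e, e \in E -> 0 < l e) ->
     [/\ forall B, min_weight_base L A (star_weight l) B ->
           shortest_stu_path E Ss u l (graph_part B),
         forall B B', min_weight_base L A (star_weight l) B ->
           min_weight_base L A (star_weight l) B' ->
           graph_part B = graph_part B' -> B = B'
       & forall P, shortest_stu_path E Ss u l P ->
           exists2 B, min_weight_base L A (star_weight l) B
                    & graph_part B = P]).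
Proof.
move=> A; split.
  move=> lgv P s pathP; split.
    by rewrite !mulf_neq0 ?signr_eq0 // (stu_path_perm_neq0 _ pathP).
  move=> B baseB.
  have [P' [s' [pathP' _ ->]]] := parity_base_path simpleE no_terminal_edge
    u_uniq u_enum x_uniq x_enum L_enum b_indep tail_end baseB.
  rewrite (lgv _ _ _ _ pathP' pathP).
  have [F2k_s [p [_ parts_s _ _]]] := pathP.
  have [F2k_s' [p' [_ parts_s' _ _]]] := pathP'.
  (* Both products become the same expression in the numbers of terminals of each part. *)
  by rewrite !(c_pathE b u_sorted).
move=> R l l_gt0; split.
- move=> B; exact: min_weight_base_shortest.
- move=> B B' minB minB' eqBB'.
  have completion := parity_base_completion simpleE no_terminal_edge
    u_uniq u_enum x_uniq x_enum L_uniq L_enum b_indep tail_end.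
  have stu_path_part := min_weight_base_path simpleE no_terminal_edge
    u_uniq u_enum x_uniq x_enum L_uniq L_enum b_indep tail_end l_gt0.
  have [[baseB _] [baseB' _]] := (minB, minB').
  (* Each of the two bases is the completion of its own graph part. *)
  rewrite (completion _ baseB (stu_path_part _ minB)).
  by rewrite (completion _ baseB' (stu_path_part _ minB')) eqBB'.
- move=> P shortP; exists (star_completion P); last exact: graph_part_completion.
  exact: shortest_min_weight_base shortP.
Qed.
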